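(* Let $X$ be the generic symmetric $n\times n$ matrix. For $0\le k\le n$, $$H\bigl(S/\mathrm{Ann}(\mathrm{perm}(X))\bigr)_k=\frac{\binom nk\left(\binom nk+1\right)}{2}.$$ Consequently $$\dim_{\mathsf k} S/\mathrm{Ann}(\mathrm{perm}(X))=\frac{\binom{2n}{n}+2^n}{2}.$$
   Context: Let $\mathsf k$ be an infinite field of characteristic zero or characteristic $p>2$. $X=(x_{ij})$ is the generic symmetric $n\times n$ matrix: its entries $x_{ij}=x_{ji}$, $1\le i\le j\le n$, are $n(n+1)/2$ distinct variables; $\mathrm{perm}(X)$ is its permanent. $R=\mathsf k[x_{ij}: i\le j]$, $S=\mathsf k[y_{ij}: i\le j]$, and $S$ acts on $R$ by differentiation ($y_{ij}$ acts as $\partial/\partial x_{ij}$; action written $h\circ F$). $\mathrm{Ann}(F)=\{h\in S:h\circ F=0\}$. $H(A)_k=\dim_{\mathsf k}A_k$ is the Hilbert function of a graded algebra $A$. *)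

(* Defs.v *)
From HB Require Import structures.
From mathcomp Require Import all_boot all_order all_fingroup all_algebra.
From mathcomp Require Import generic_quotient ring_quotient.
From mathcomp Require Import ssrcomplements.
From mathcomp Require Export mpoly.

Set Implicit Arguments.
Unset Strict Implicit.
Unset Printing Implicit Defensive.

Import GRing.Theory.
Local Open Scope ring_scope.
Local Open Scope quotient_scope.

(* [is_dim U d] is used only for linear subspaces [U] of [V]. *)
Definition is_dim (K : fieldType) (V : lmodType K) (U : V -> Prop) (d : nat) :
    Prop :=
  exists b : 'I_d -> V,
    [/\ forall i, U (b i),
        forall c : 'I_d -> K, \sum_i c i *: b i = 0 -> forall i, c i = 0
      & forall v, U v -> exists c : 'I_d -> K, v = \sum_i c i *: b i].

Section Dimension.
Variables (K : fieldType) (V : lmodType K) (U : V -> Prop).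

Lemma is_dim_leq d e : is_dim U d -> is_dim U e -> (d <= e)%N.
Proof.
move=> [b [Ub b_free _]] [b' [_ _ b'_span]].
pose P i (c : 'rV[K]_e) := b i = \sum_j c 0 j *: b' j.
have exP i : exists c, P i c.
  have [c bE] := b'_span _ (Ub i).
  by exists (\row_j c j); rewrite /P bE; apply: eq_bigr => j _; rewrite mxE.
have [M ME] : exists M : 'M[K]_(d, e), forall i, b i = \sum_j M i j *: b' j.
  have [s sE] : exists f : {ffun 'I_d -> 'rV[K]_e}, forall i, P i (f i).
    elim: (d) b P exP {Ub b_free} => [|n IH] b P exP.
      by exists [ffun=> 0] => -[].
    have [f fE] := IH (b \o lift ord0) _ (fun i => exP (lift ord0 i)).
    have [c cE] := exP ord0.
    exists [ffun i => if unlift ord0 i is Some j then f j else c] => i.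
    by rewrite ffunE; case: unliftP => [j|] ->.
  exists (\matrix_(i, j) s i 0 j) => i.
  by rewrite sE; apply: eq_bigr => j _; rewrite mxE.
rewrite -(_ : \rank M = d) ?rank_leq_col //; apply/eqP.
change (row_free M); rewrite -kermx_eq0; apply/eqP/row_matrixP => i.
rewrite row0; apply/rowP => k; rewrite [RHS]mxE.
apply: (b_free (fun k => row i (kermx M) 0 k)).
have: row i (kermx M) *m M = 0 by rewrite -row_mul mulmx_ker row0.
move: (row _ _) => r rM0.
under eq_bigr do rewrite ME scaler_sumr.
rewrite exchange_big big1 //= => j _.
under eq_bigr do rewrite scalerA.
rewrite -scaler_suml; have /rowP/(_ j) := rM0.
by rewrite !mxE => ->; rewrite scale0r.
Qed.

Lemma is_dim_inj d e : is_dim U d -> is_dim U e -> d = e.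
Proof.
by move=> Ud Ue; apply/eqP; rewrite eqn_leq (is_dim_leq Ud Ue) (is_dim_leq Ue Ud).
Qed.

End Dimension.

Section Apolarity.
Variables (K : fieldType) (m : nat).
Implicit Types (F g h : {mpoly K[m]}).

(* The action h o F of S on R, both rings being represented by {mpoly K[m]}:
   the i-th variable of S acts as the partial derivative along the i-th
   variable of R. *)
Definition diff_act h F : {mpoly K[m]} :=
  \sum_(u <- msupp h) h@_u *: F^`M[u].

Lemma diff_act_wE k h F : (msize h <= k)%N ->
  diff_act h F = \sum_(u : 'X_{1..m < k}) h@_u *: F^`M[u].
Proof.
move=> le_hk; rewrite /diff_act.
rewrite (big_mksub 'X_{1..m < k}) ?msupp_uniq //=; last first.
  by move=> u /msize_mdeg_lt /leq_trans; apply.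
by rewrite big_rmcond //= => u /memN_msupp_eq0 ->; rewrite scale0r.
Qed.

Definition diff_actr F h := diff_act h F.

Lemma diff_act_linear F : linear (diff_actr F).
Proof.
move=> a g h; rewrite /diff_actr; pose k := maxn (msize (a *: g + h)) (maxn (msize g) (msize h)).
rewrite !(@diff_act_wE k) ?leq_max ?leqnn ?orbT //.
rewrite scaler_sumr -big_split /=; apply: eq_bigr => u _.
by rewrite mcoeffD mcoeffZ scalerDl scalerA.
Qed.

HB.instance Definition _ F :=
  GRing.isLinear.Build K {mpoly K[m]} {mpoly K[m]} _ (diff_actr F)
    (diff_act_linear F).

Lemma diff_actXE u F : diff_act 'X_[u] F = F^`M[u].
Proof. by rewrite /diff_act msuppX big_seq1 mcoeffX eqxx scale1r. Qed.

Lemma diff_actM g h F : diff_act (g * h) F = diff_act g (diff_act h F).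
Proof.
have actXM u h' : diff_act ('X_[u] * h') F = (diff_act h' F)^`M[u].
  rewrite [h' in LHS]mpolyE mulr_sumr -[LHS]/(diff_actr F _) linear_sum /=.
  rewrite [in RHS]/diff_act raddf_sum; apply: eq_bigr => v _ /=.
  rewrite -scalerAr linearZ /= -mpolyXD /diff_actr diff_actXE.
  by rewrite mderivmZ addmC mderivmDm.
rewrite [g in LHS]mpolyE mulr_suml -[LHS]/(diff_actr F _) linear_sum /=.
apply: eq_bigr => u _.
by rewrite -scalerAl linearZ /= /diff_actr actXM.
Qed.

Definition Ann F : {pred {mpoly K[m]}} := fun h => diff_act h F == 0.

Lemma Ann_zmod_closed F : zmod_closed (Ann F).
Proof.
have AnnE h : (h \in Ann F) = (diff_act h F == 0) by [].
split=> [|g h]; rewrite !AnnE; first by rewrite -[diff_act _ _]/(diff_actr F _) linear0.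
move=> /eqP g0 /eqP h0.
by rewrite -/(diff_actr F _) linearB /= /diff_actr g0 h0 subrr.
Qed.

HB.instance Definition _ F :=
  GRing.isZmodClosed.Build {mpoly K[m]} (Ann F) (Ann_zmod_closed F).

Lemma AnnMl F g h : h \in Ann F -> g * h \in Ann F.
Proof.
rewrite !unfold_in => /eqP h0; rewrite diff_actM h0 /diff_act big1 // => u _.
by rewrite raddf0 scaler0.
Qed.

(* S / Ann(F) as a K-vector space. *)
Definition apolar_quot F := {ideal_quot (Ann F)}.

HB.instance Definition _ F := GRing.Zmodule.on (apolar_quot F).

Definition apolar_pi F (h : {mpoly K[m]}) : apolar_quot F :=
  \pi_(apolar_quot F) h.

Lemma apolar_piE F g h :
  (apolar_pi F g == apolar_pi F h) = (g - h \in Ann F).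
Proof. by rewrite -Quotient.idealrBE. Qed.

Definition apolar_scale F (a : K) (q : apolar_quot F) : apolar_quot F :=
  apolar_pi F (a *: repr q).

Lemma apolar_scale_pi F a h : apolar_scale a (apolar_pi F h) = apolar_pi F (a *: h).
Proof.
apply/eqP; rewrite apolar_piE -scalerBr -mul_mpolyC AnnMl //.
by rewrite -apolar_piE /apolar_pi reprK.
Qed.

Lemma apolar_piD F g h : apolar_pi F (g + h) = apolar_pi F g + apolar_pi F h.
Proof. exact: raddfD. Qed.

Lemma apolar_piP F (q : apolar_quot F) : exists h, q = apolar_pi F h.
Proof. by exists (repr q); rewrite /apolar_pi reprK. Qed.

Lemma apolar_scalerA F a b (q : apolar_quot F) :
  apolar_scale a (apolar_scale b q) = apolar_scale (a * b) q.
Proof.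
by have [h ->] := apolar_piP q; rewrite !apolar_scale_pi scalerA.
Qed.

Lemma apolar_scale1r F : left_id 1 (@apolar_scale F).
Proof.
by move=> q; have [h ->] := apolar_piP q; rewrite apolar_scale_pi scale1r.
Qed.

Lemma apolar_scalerDr F : right_distributive (@apolar_scale F) +%R.
Proof.
move=> a q r; have [g ->] := apolar_piP q; have [h ->] := apolar_piP r.
by rewrite -apolar_piD !apolar_scale_pi scalerDr apolar_piD.
Qed.

Lemma apolar_scalerDl F (q : apolar_quot F) :
  {morph (@apolar_scale F)^~ q : a b / a + b}.
Proof.
move=> a b /=; have [h ->] := apolar_piP q.
by rewrite !apolar_scale_pi scalerDl apolar_piD.
Qed.

HB.instance Definition _ F :=
  GRing.Zmodule_isLmodule.Build K (apolar_quot F)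
    (@apolar_scalerA F) (@apolar_scale1r F) (@apolar_scalerDr F)
    (@apolar_scalerDl F).

Lemma apolar_pi_linear F : linear (apolar_pi F).
Proof. by move=> a g h; rewrite apolar_piD -apolar_scale_pi. Qed.

HB.instance Definition _ F :=
  GRing.isLinear.Build K {mpoly K[m]} (apolar_quot F) _ (apolar_pi F)
    (apolar_pi_linear F).

(* The degree-k piece of S / Ann(F): the image of the forms of degree k of S
   (0 included). It is the grading of the quotient when F is homogeneous. *)
Definition graded_piece F (k : nat) (q : apolar_quot F) : Prop :=
  exists2 h : {mpoly K[m]}, h \is k.-homog & q = apolar_pi F h.

End Apolarity.

Arguments graded_piece {K m} F k q.

(* The variables x_ij, i <= j, of the generic symmetric n x n matrix. *)
Definition sym_var (n : nat) := {p : 'I_n * 'I_n | (p.1 <= p.2)%N}.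

Lemma sym_pair_subproof n (i j : 'I_n) :
  let p := if (i <= j)%N then (i, j) else (j, i) in (p.1 <= p.2)%N.
Proof. by case: leqP => //= /ltnW. Qed.

Definition sym_pair n (i j : 'I_n) : sym_var n :=
  exist _ (if (i <= j)%N then (i, j) else (j, i)) (sym_pair_subproof i j).

Definition generic_sym (K : fieldType) (n : nat) :
    'M[{mpoly K[#|{: sym_var n}|]}]_n :=
  \matrix_(i, j) 'X_(enum_rank (sym_pair i j)).

Definition permanent (R : comNzRingType) (n : nat) (A : 'M[R]_n) : R :=
  \sum_(s : 'S_n) \prod_i A i (s i).

(* Main.v *)
Require Import Defs.
From mathcomp Require Import all_boot all_fingroup all_algebra.
From mathcomp Require Import zify mpoly.

(** Write F for the permanent of the generic symmetric matrix X, and X[C, D]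
    for the submatrix of X on the rows C and the columns D. Since h |-> h o F
    has kernel Ann(F), the quotient S / Ann(F) is isomorphic to S o F, and the
    theorem says that the permanents perm X[~: A, ~: B], for the unordered
    pairs {A, B} of sets of the same size k, form a basis of S_k o F.

    The derivative of perm X[C, D] along x_ij is
      perm X[C - i, D - j] + perm X[C - j, D - i],
    where the second term is absent if i = j (and where the permanents which
    make no sense are zero); this is mderiv_subperm. So S_k o F lies in the
    span of the perm X[~: A, ~: B] with #|A| = #|B| = k.

    Everything else rests on minor_pair_realizable: whenever #|A| = #|B| = k,
    some form h of degree k satisfies
      h o perm X[C, D] = perm X[C - A, D - B] + perm X[C - B, D - A]
    for all C and D at once. On C = D = everything this gives
    h o F = 2 perm X[~: A, ~: B], hence all these permanents lie in S_k o F. On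
    the other hand, the constant coefficient of h o perm X[C, D] is nonzero
    exactly when {C, D} = {A, B}, so that these forms separate the permanents
    of submatrices, which are therefore linearly independent (subperm_free).

    The form h is built by induction on k. If A and B share an index i,
    multiply by y_ii the form of (A - i, B - i). If they are disjoint,
    multiplying by y_ab the form of (A - a, B - b) realizes T + T', where T is
    the right-hand side wanted for (A, B), and T' the one for the pair obtained
    by exchanging a in A with b in B. The exchange graph has triangles: for a in
    A and b, c in B, the three pairs in which respectively a, b or c sits on the
    side of A - a are two by two exchanges of one another. From T + T', T' + T''
    and T + T'' one extracts 2T, and 2 is invertible. When k = 1, T' = T by
    symmetry.

    It remains to count the unordered pairs: twice their number is the number
    of ordered pairs (A, B) plus the number of diagonal ones. The count is made
    for an arbitrary set Q of allowed sizes, because both claims of the theorem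
    are instances: Q = {k} for the graded piece, all sizes for the whole
    quotient, where the sum of squares of binomials is Vandermonde's. *)

Set Implicit Arguments.
Unset Strict Implicit.
Unset Printing Implicit Defensive.

Import GRing.Theory.
Local Open Scope ring_scope.

(** * Bilinearity of the differentiation action *)

Section DiffAct.
Variables (K : fieldType) (m : nat).
Implicit Types (F G h : {mpoly K[m]}).

Lemma diff_actD g h F : diff_act (g + h) F = diff_act g F + diff_act h F.
Proof. exact: (linearD (diff_actr F)). Qed.

Lemma diff_actZ a h F : diff_act (a *: h) F = a *: diff_act h F.
Proof. by rewrite -[LHS]/(diff_actr F _) linearZ. Qed.

Lemma diff_act_sum (J : Type) (r : seq J) (P : pred J)
    (f : J -> {mpoly K[m]}) F :
  diff_act (\sum_(j <- r | P j) f j) F = \sum_(j <- r | P j) diff_act (f j) F.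
Proof. exact: (linear_sum (diff_actr F)). Qed.

Lemma diff_act0r h : diff_act h 0 = 0.
Proof. by rewrite /diff_act big1 // => u _; rewrite linear0 scaler0. Qed.

Lemma diff_actZr a h F : diff_act h (a *: F) = a *: diff_act h F.
Proof.
rewrite /diff_act scaler_sumr; apply: eq_bigr => u _.
by rewrite linearZ /= !scalerA mulrC.
Qed.

Lemma diff_act_sumr (J : Type) (r : seq J) (P : pred J)
    (f : J -> {mpoly K[m]}) h :
  diff_act h (\sum_(j <- r | P j) f j) = \sum_(j <- r | P j) diff_act h (f j).
Proof.
rewrite /diff_act exchange_big; apply: eq_bigr => u _.
by rewrite linear_sum scaler_sumr.
Qed.

Lemma diff_act1 F : diff_act 1 F = F.
Proof. by rewrite -mpolyX0 diff_actXE mderivm0m. Qed.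

Lemma diff_act_var a F : diff_act 'X_a F = mderiv a F.
Proof. by rewrite diff_actXE mderivmU1m. Qed.

Lemma mderiv_prod (J : finType) (A : {set J}) (f : J -> {mpoly K[m]}) a :
  mderiv a (\prod_(x in A) f x)
  = \sum_(x in A) mderiv a (f x) * \prod_(y in A :\ x) f y.
Proof.
elim: {A}#|A| {-2}A (leqnn #|A|) => [|k IH] A leA.
  have -> : A = set0 by apply/eqP; rewrite -cards_eq0 -leqn0.
  by rewrite !big_set0 mderivC.
have [->|[x xA]] := set_0Vmem A; first by rewrite !big_set0 mderivC.
rewrite (big_setD1 x xA) mderivM IH; last first.
  by rewrite -ltnS (leq_trans _ leA) // [X in (_ < X)%N](cardsD1 x) xA.
rewrite [RHS](big_setD1 x xA) /=; congr (_ + _).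
rewrite mulr_sumr; apply: eq_bigr => y.
rewrite in_setD1 => /andP[nyx yA].
have xAy : x \in A :\ y by rewrite in_setD1 eq_sym nyx.
by rewrite (big_setD1 x xAy) /= mulrCA !setDDl [[set x] :|: _]setUC.
Qed.

End DiffAct.

(** * Bijections between subsets, as sets of pairs *)

Section Pairings.
Variable I : finType.
Implicit Types (A B C D : {set I}) (G : {set I * I}).

(** The graphs of the bijections from C to D, described by row and column sums:
    removing a pair (i, j) from G then just lowers one sum on each side. *)
Definition pairing C D G :=
  [forall i, (\sum_j ((i, j) \in G) == (i \in C))%N]
  && [forall j, (\sum_i ((i, j) \in G) == (j \in D))%N].

Lemma pairingP C D G :
  reflect ((forall i, \sum_j ((i, j) \in G) = (i \in C))%N
           /\ (forall j, \sum_i ((i, j) \in G) = (j \in D))%N)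
          (pairing C D G).
Proof.
apply: (iffP andP) => [[/'forall_eqP-HC /'forall_eqP-HD]|[HC HD]]; first by [].
by split; apply/'forall_eqP.
Qed.

Definition flip G : {set I * I} := [set e | (e.2, e.1) \in G].

Lemma flipK : involutive flip.
Proof. by move=> G; apply/setP => -[i j]; rewrite !inE. Qed.

Lemma pairing_flip C D G : pairing C D (flip G) = pairing D C G.
Proof.
rewrite /pairing andbC; congr andb; apply: eq_forallb => i; congr (_ == _);
  by apply: eq_bigr => j _; rewrite inE.
Qed.

Lemma pairing_mem C D G e :
  pairing C D G -> e \in G -> (e.1 \in C) && (e.2 \in D).
Proof.
case: e => i j /pairingP[HC HD] eG /=.
move: (HC i) (HD j); rewrite (bigD1 j) //= [in X in _ -> X](bigD1 i) //= eG.
by case: (i \in C) => //; case: (j \in D).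
Qed.

Lemma pairing_notin C D G i j : pairing (C :\ i) (D :\ j) G -> (i, j) \notin G.
Proof. by move=> HG; apply/negP => /(pairing_mem HG); rewrite !inE eqxx. Qed.

(** This is what makes the expansion of a permanent along a pair, and hence its
    derivatives, again permanents of submatrices. *)
Lemma pairing_setU1 C D G i j : i \in C -> j \in D ->
  (i, j) \notin G -> pairing C D ((i, j) |: G) = pairing (C :\ i) (D :\ j) G.
Proof.
move=> iC jD nG.
have memE k l : ((k, l) \in (i, j) |: G)
    = ((k == i) && (l == j) + ((k, l) \in G))%N :> nat.
  rewrite !inE xpair_eqE; case: eqP => [->|_] //=; case: eqP => [->|_] //=.
  by rewrite (negPf nG).
rewrite /pairing; congr andb; apply: eq_forallb => k.
  under eq_bigr do rewrite memE.
  rewrite big_split /= (bigD1 j) //= eqxx andbT big1 ?addn0; last first.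
    by move=> l /negPf ->; rewrite andbF.
  by rewrite in_setD1; have [->|_] := eqVneq k i; rewrite ?iC ?eqSS.
under eq_bigr do rewrite memE.
rewrite big_split /= (bigD1 i) //= eqxx /= big1 ?addn0; last first.
  by move=> l /negPf ->.
by rewrite in_setD1; have [->|_] := eqVneq k j; rewrite ?jD ?eqSS.
Qed.

Lemma pairing_set0 C D : pairing C D set0 = (C == set0) && (D == set0).
Proof.
apply/pairingP/andP => [[HC HD]|[/eqP-> /eqP->]]; last first.
  by split=> i; rewrite inE big1 // => j _; rewrite inE.
by split; apply/eqP/setP => i; rewrite inE; apply/negbTE; rewrite -eqb0 -?HC -?HD;
  rewrite big1 // => j _; rewrite inE.
Qed.

End Pairings.

Section Graph.
Variable n : nat.
Implicit Type s : 'S_n.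

Definition graph s : {set 'I_n * 'I_n} := [set e | s e.1 == e.2].

Lemma pairing_graph s : pairing setT setT (graph s).
Proof.
apply/pairingP; split=> i; rewrite inE.
  rewrite (bigD1 (s i)) //= inE eqxx big1 // => j.
  by rewrite inE eq_sym => /negPf->.
rewrite (bigD1 (s^-1%g i)) //= inE permKV eqxx big1 // => j.
by rewrite inE -(canF_eq (permK s)) => /negPf->.
Qed.

Lemma graph_inj : injective graph.
Proof.
move=> s t /setP st; apply/permP => i.
by have := st (i, t i); rewrite !inE /= eqxx => /eqP.
Qed.

(** The sums being 1 make G the graph of a total, single-valued and injective
    map. *)
Lemma pairing_permP G : pairing setT setT G -> exists s, G = graph s.
Proof.
move=> /pairingP[HC HD].
have col i : {j | (i, j) \in G}.
  apply: sigW; apply/existsP; have := HC i; rewrite inE => sum1.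
  apply: contraPT sum1; rewrite negb_exists => /forallP none.
  by rewrite big1 // => j _; rewrite (negPf (none j)).
pose f i := sval (col i).
have fG i : (i, f i) \in G by exact: svalP (col i).
have f_uniq i j : (i, j) \in G -> j = f i.
  move=> ijG; apply: contra_eq (HC i) => ne; rewrite inE.
  by rewrite (bigD1 j) //= (bigD1 (f i)) 1?eq_sym //= ijG fG.
have f_inj : injective f.
  move=> i k fik; apply: contra_eq (HD (f i)) => ne; rewrite inE.
  by rewrite (bigD1 i) //= (bigD1 k) 1?eq_sym //= fG fik fG.
exists (perm f_inj); apply/setP => -[i j]; rewrite inE permE /=.
by apply/idP/eqP => [/f_uniq //|<-].
Qed.

End Graph.

(** * Permanents of submatrices of the generic symmetric matrix *)

Section Subpermanents.
Variables (K : fieldType) (n : nat).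
Local Notation I := 'I_n.
Local Notation R := {mpoly K[#|{: sym_var n}|]}.
Implicit Types (A B C D : {set I}) (i j : I).

Definition var i j : 'I_#|{: sym_var n}| := enum_rank (sym_pair i j).

Lemma var_eq i j k l :
  (var i j == var k l) = ((i, j) == (k, l)) || ((i, j) == (l, k)).
Proof.
rewrite (inj_eq enum_rank_inj) -val_eqE /=.
by case: (leqP i j) => ij; case: (leqP k l) => kl;
   rewrite !xpair_eqE -!val_eqE /=; lia.
Qed.

Lemma varC i j : var i j = var j i.
Proof. by apply/eqP; rewrite var_eq eqxx orbT. Qed.

Lemma var_surj a : exists i j, a = var i j.
Proof.
case def_p: (enum_val a) => [[i j] /= ij]; exists i, j.
apply: enum_val_inj; rewrite enum_rankK def_p; apply: val_inj => /=.
by rewrite ij.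
Qed.

(** The permanent of X[C, D], which is 0 unless C and D have the same size. *)
Definition subperm C D : R :=
  \sum_(G | pairing C D G) \prod_(e in G) 'X_(var e.1 e.2).

(** Transposition, since X is symmetric. *)
Lemma subpermC C D : subperm C D = subperm D C.
Proof.
rewrite /subperm (reindex_inj (inv_inj (@flipK _))) /=.
apply: eq_big => G; first by rewrite pairing_flip.
have swapK : involutive (fun e : I * I => (e.2, e.1)) by case.
move=> _; rewrite (reindex_inj (inv_inj swapK)) /=.
apply: eq_big => [[i j]|[i j] _]; first by rewrite !inE.
by rewrite varC.
Qed.

(** Pairings of the full index set with itself are graphs of permutations. *)
Lemma subpermT : subperm setT setT = permanent (generic_sym K n).
Proof.
rewrite /subperm /permanent.
pose h (G : {set I * I}) := odflt 1%g [pick s | G == graph s].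
rewrite (reindex_onto (@graph n) h) => [|G /pairing_permP[s ->]]; last first.
  by rewrite /h; case: pickP => [t /eqP|/(_ s)/eqP].
apply: eq_big => s.
  rewrite pairing_graph /h; case: pickP => [t /eqP/graph_inj->|/(_ s)/eqP //].
  by rewrite eqxx.
move=> _; rewrite (reindex_onto (fun i => (i, s i)) fst) /= => [|[i j]]; last first.
  by rewrite inE => /eqP /= ->.
apply: eq_big => i; first by rewrite inE /= !eqxx.
by rewrite mxE.
Qed.

(** The cofactor of the entry e in the Laplace expansion of the permanent of
    X[C, D], or 0 if e lies outside the submatrix. *)
Definition contract e C D : R :=
  if (e.1 \in C) && (e.2 \in D) then subperm (C :\ e.1) (D :\ e.2) else 0.

(** Removing e is a bijection from the pairings of C with D through e onto the
    pairings of the two sets deprived of the coordinates of e. *)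
Lemma contractE e C D :
  \sum_(G | pairing C D G && (e \in G)) \prod_(f in G :\ e) 'X_(var f.1 f.2)
  = contract e C D.
Proof.
case: e => i j; rewrite /contract /=; case: ifP => [/andP[iC jD]|nCD]; last first.
  by rewrite big1 // => G /andP[/pairing_mem mG /mG] /=; rewrite nCD.
rewrite (reindex_onto (fun G => (i, j) |: G) (fun G => G :\ (i, j))) /=; last first.
  by move=> G /andP[_ eG]; rewrite setD1K.
apply: eq_big => G; last first.
  by case/andP=> _ /eqP eqG; apply: eq_bigl => f; rewrite -[in RHS]eqG.
rewrite setU11 andbT; have [eG|neG] := boolP ((i, j) \in G).
  rewrite (setUidPr _) ?sub1set // (_ : (_ == _) = false) ?andbF; last first.
    by apply/eqP => /setP/(_ (i, j)); rewrite !inE eqxx eG.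
  by symmetry; apply: contraTF eG => /pairing_notin.
by rewrite setU1K // eqxx andbT pairing_setU1.
Qed.

(** The variable of (i, j) occurs at the entries (i, j) and (j, i) of X, and in
    one monomial it may occur twice (when a bijection exchanges i and j):
    differentiating the product entry by entry counts both occurrences. *)
Lemma mderiv_subperm i j C D :
  mderiv (var i j) (subperm C D)
  = contract (i, j) C D + (if i != j then contract (j, i) C D else 0).
Proof.
rewrite /subperm linear_sum /=.
under eq_bigr do rewrite mderiv_prod.
rewrite (exchange_big_dep predT) //=.
have termE (e : I * I) : \sum_(G | pairing C D G && (e \in G))
    mderiv (var i j) ('X_(var e.1 e.2) : R)
      * \prod_(f in G :\ e) 'X_(var f.1 f.2)
  = if var e.1 e.2 == var i j then contract e C D else 0.
  rewrite -mulr_sumr contractE mderivX mnm1E; case: eqP => [->|_].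
    by rewrite -{1}[U_(_)%MM]add0m addmK mpolyX0 scale1r mul1r.
  by rewrite scale0r mul0r.
rewrite (eq_bigr _ (fun e _ => termE e)) -big_mkcond /=.
rewrite (eq_bigl (fun e => (e == (i, j)) || (e == (j, i)))); last first.
  by move=> [k l]; rewrite /= var_eq.
rewrite (bigD1 (i, j)) ?eqxx //=; congr (_ + _).
rewrite (eq_bigl (fun e => (e == (j, i)) && (i != j))).
  case: ifP => nij; last by rewrite big_pred0 // => e; rewrite andbF.
  by rewrite (eq_bigl (pred1 (j, i))) ?big_pred1_eq // => e; rewrite andbT.
by move=> [k l]; rewrite /= !xpair_eqE -!val_eqE /=; lia.
Qed.

Lemma mcoeff0_subperm C D : (subperm C D)@_0 = ((C == set0) && (D == set0))%:R.
Proof.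
rewrite /subperm linear_sum /= (bigID (pred1 set0)) /=.
rewrite [X in _ + X]big1 ?addr0.
  under eq_bigl => G do rewrite andbC.
  rewrite big_mkcondr /= big_pred1_eq pairing_set0.
  by case: ifP => _; rewrite ?mcoeff0 // big_set0 mcoeff1 eqxx.
move=> G /andP[_ /set0Pn[e eG]]; rewrite (big_setD1 e eG) /=.
by rewrite rmorphM /= mcoeffX -mdeg_eq0 mdeg1 mul0r.
Qed.

(** * Forms that remove a given pair of sets *)

Definition minor A B C D : R :=
  if (A \subset C) && (B \subset D) then subperm (C :\: A) (D :\: B) else 0.

(** Removing i and j after A and B amounts to removing them together, the
    membership and inclusion tests being regrouped accordingly. *)
Lemma contract_minor A B C D i j :
  (if (A \subset C) && (B \subset D)
   then contract (i, j) (C :\: A) (D :\: B) else 0)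
  = if (i \notin A) && (j \notin B) then minor (i |: A) (j |: B) C D else 0.
Proof.
rewrite /contract /minor /= !inE !subUset !sub1set !setDDl ![_ :|: [set _]]setUC.
do 4?case: (_ \in _); do 2?case: (_ \subset _); rewrite /= ?andbF //.
Qed.

Lemma mderiv_minor A B C D i j :
  mderiv (var i j) (minor A B C D)
  = (if (i \notin A) && (j \notin B) then minor (i |: A) (j |: B) C D else 0)
    + (if [&& i != j, j \notin A & i \notin B]
       then minor (j |: A) (i |: B) C D else 0).
Proof.
have := contract_minor A B C D j i; have := contract_minor A B C D i j.
rewrite [minor A B C D]/minor; case: ifP => _ <-.
  by rewrite mderiv_subperm; case: eqVneq => _ //= <-.
by rewrite mderiv0; case: eqVneq => _ /= => [_|<-]; rewrite addr0.
Qed.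

(** X[C, D] and X[D, C] have the same permanent, so an action on permanents takes
    the same value on (C, D) and on (D, C); minor A B lacks this symmetry
    in general, which its sum with minor B A has. *)
Definition minor_pair A B C D : R := minor A B C D + minor B A C D.

Lemma minor_pairC A B C D : minor_pair A B C D = minor_pair B A C D.
Proof. exact: addrC. Qed.

Lemma mderiv_minor_pair A B C D i j :
  mderiv (var i j) (minor_pair A B C D)
  = (if (i \notin A) && (j \notin B)
     then minor_pair (i |: A) (j |: B) C D else 0)
    + (if [&& i != j, j \notin A & i \notin B]
       then minor_pair (j |: A) (i |: B) C D else 0).
Proof.
rewrite /minor_pair mderivD !mderiv_minor addrACA.
rewrite [(i \notin B) && _]andbC; have [->|_] /= := eqVneq i j.
  by rewrite !addr0; case: ifP => //; rewrite addr0.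
rewrite [(j \notin B) && _]andbC [X in _ + X]addrC addrACA.
congr (_ + _); first by case: ifP; rewrite ?addr0.
by rewrite addrC; case: ifP; rewrite ?addr0.
Qed.

(** t is the action of one form of degree k on the permanents of all the
    submatrices simultaneously. *)
Definition realizable k (t : {set I} -> {set I} -> R) :=
  exists2 h : R, h \is k.-homog & forall C D, diff_act h (subperm C D) = t C D.

Lemma realizable_ext k s t : (forall C D, s C D = t C D) ->
  realizable k s -> realizable k t.
Proof. by move=> st [h hk hE]; exists h => // C D; rewrite hE. Qed.

Lemma realizableD k s t : realizable k s -> realizable k t ->
  realizable k (fun C D => s C D + t C D).
Proof.
move=> [g gk gE] [h hk hE]; exists (g + h); first exact: rpredD.
by move=> C D; rewrite diff_actD gE hE.
Qed.

Lemma realizableZ k a t : realizable k t -> realizable k (fun C D => a *: t C D).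
Proof.
move=> [h hk hE]; exists (a *: h); first exact: dhomogZ.
by move=> C D; rewrite diff_actZ hE.
Qed.

Lemma realizable_mderiv k t i j : realizable k t ->
  realizable k.+1 (fun C D => mderiv (var i j) (t C D)).
Proof.
move=> [h hk hE]; exists ('X_(var i j) * h).
  by rewrite -add1n; apply: dhomogM; rewrite ?dhomogX /= ?mdeg1.
by move=> C D; rewrite diff_actM diff_act_var hE.
Qed.

(** Induction on the size, by exchanges of elements between A and B: three
    exchanges around a triangle leave twice the desired action. *)
Lemma minor_pair_realizable A B : 2%:R != 0 :> K -> #|A| = #|B| ->
  realizable #|A| (minor_pair A B).
Proof.
move=> nz2 cB; have [k cA] : exists k, #|A| = k by exists #|A|.
have {}cB : #|B| = k by rewrite -cB.
rewrite cA; elim: k A B cA cB => [|k IH] A B cA cB.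
  have -> : A = set0 by apply/eqP; rewrite -cards_eq0 cA.
  have -> : B = set0 by apply/eqP; rewrite -cards_eq0 cB.
  exists (2%:R *: 1); first by apply: dhomogZ; apply: dhomog1.
  move=> C D; rewrite diff_actZ diff_act1 /minor_pair /minor !sub0set !setD0.
  by rewrite scaler_nat.
have cD1 (X : {set I}) x : #|X| = k.+1 -> x \in X -> #|X :\ x| = k.
  by move=> cX xX; move: cX; rewrite (cardsD1 x) xX => -[].
(* A common index can be removed from both sides by its diagonal variable. *)
have [|/set0Pn[i]] := boolP (A :&: B == set0); last first.
  rewrite inE => /andP[iA iB].
  have := realizable_mderiv i i (IH (A :\ i) (B :\ i) _ _).
  rewrite !cD1 // => /(_ erefl erefl); apply: realizable_ext => C D.
  by rewrite mderiv_minor_pair !setD11 eqxx /= addr0 !setD1K.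
rewrite setI_eq0 => /pred0P-dAB.
have {dAB} dAB x : x \in A -> x \notin B.
  by move=> xA; have /= := dAB x; rewrite xA /= => ->.
(* Exchanging a and b changes the sign of minor_pair up to realizable actions. *)
have swap (X Y : {set I}) a b : #|X| = k.+1 -> #|Y| = k.+1 ->
    (forall x, x \in X -> x \notin Y) ->
    a \in X -> b \in Y -> realizable k.+1 (fun C D =>
      minor_pair X Y C D + minor_pair (b |: X :\ a) (a |: Y :\ b) C D).
  move=> cX cY dXY aX bY.
  have := realizable_mderiv a b (IH (X :\ a) (Y :\ b) _ _).
  rewrite !cD1 // => /(_ erefl erefl); apply: realizable_ext => C D.
  have nab : a != b by apply: contraTneq bY => <-; apply: dXY.
  have naY : a \notin Y by apply: dXY.
  have nbX : b \notin X by apply: contraL bY => /dXY.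
  rewrite mderiv_minor_pair !inE !eqxx nab (negPf naY) (negPf nbX) andbF /=.
  by rewrite !setD1K.
have [a aA] : exists a, a \in A by apply/card_gt0P; rewrite cA.
have [b bB] : exists b, b \in B by apply/card_gt0P; rewrite cB.
have half t : realizable k.+1 (fun C D => t C D + t C D) -> realizable k.+1 t.
  move=> /(realizableZ 2%:R^-1); apply: realizable_ext => C D.
  by rewrite -mulr2n -scaler_nat scalerA mulVf // scale1r.
have naB : a \notin B := dAB a aA.
have nbA : b \notin A by apply: contraL bB => /dAB.
have ab := swap A B a b cA cB dAB aA bB.
(* For singletons, the exchange is the transposition of the pair. *)
have [B0|[c]] := set_0Vmem (B :\ b).
  have A0 : A :\ a = set0.
    by apply/eqP; rewrite -cards_eq0 (cD1 A) // -(cD1 B b) // B0 cards0.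
  apply: half; apply: realizable_ext ab => C D.
  by rewrite A0 B0 -(setD1K aA) -(setD1K bB) A0 B0 [X in _ + X]minor_pairC.
rewrite in_setD1 => /andP[ncb cB'].
have nac : a != c by apply: contraNneq naB => ->.
have nab : a != b by apply: contraNneq naB => ->.
have ac := swap A B a c cA cB dAB aA cB'.
(* Third side of the triangle: after a and b are exchanged, exchange b and c. *)
have bc : realizable k.+1 (fun C D => minor_pair (b |: A :\ a) (a |: B :\ b) C D
    + minor_pair (c |: A :\ a) (a |: B :\ c) C D).
  have -> : c |: A :\ a = c |: (b |: A :\ a) :\ b.
    by rewrite setU1K // in_setD1 negb_and nbA orbT.
  have -> : a |: B :\ c = b |: (a |: B :\ b) :\ c.
    apply/setP => x; rewrite !inE.
    have [->|_] := eqVneq x b; first by rewrite bB (eq_sym b c) ncb orbT.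
    by have [->|//] := eqVneq x a; rewrite nac.
  apply: swap.
  - by rewrite cardsU1 in_setD1 negb_and nbA orbT cD1.
  - by rewrite cardsU1 in_setD1 negb_and naB orbT cD1.
  - move=> x; rewrite !inE => /predU1P[->|/andP[nxa xA]].
      by rewrite eqxx (eq_sym b) (negPf nab).
    by rewrite (negPf nxa) negb_and dAB ?orbT.
  - by rewrite setU11.
  by rewrite !inE ncb cB' orbT.
apply: half.
have := realizableD (realizableD ab ac) (realizableZ (-1) bc).
apply: realizable_ext => C D.
by rewrite scaleN1r addrACA addrK.
Qed.

(** Only the empty permanent, where nothing is left of C and D, has a constant
    term. *)
Lemma mcoeff0_minor A B C D :
  (minor A B C D)@_0 = ((C == A) && (D == B))%:R.
Proof.
rewrite /minor !eqEsubset andbACA [in RHS]andbC.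
case: ifP => _ /=; last by rewrite mcoeff0.
by rewrite mcoeff0_subperm !setD_eq0.
Qed.

(** * A basis of the apolar algebra *)

(** The constant coefficient after the action of the form that removes
    (A x, B x) is a linear functional which kills every other member of the
    family, and takes the value 1 or 2 on that one. *)
Lemma subperm_free (J : finType) (A B : J -> {set I}) (c : J -> K) :
    2%:R != 0 :> K ->
    (forall x, #|A x| = #|B x|) ->
    (forall x y, A x = A y /\ B x = B y \/ A x = B y /\ B x = A y -> x = y) ->
  \sum_x c x *: subperm (A x) (B x) = 0 -> forall x, c x = 0.
Proof.
move=> nz2 cAB uniqAB sum0 l.
have [h _ hE] := minor_pair_realizable nz2 (cAB l).
have := congr1 (fun G => (diff_act h G)@_0) sum0.
rewrite /= diff_act_sumr diff_act0r.
rewrite linear_sum mcoeff0 (bigD1 l) //= big1 ?addr0 => [|j njl].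
  rewrite diff_actZr hE mcoeffZ mcoeffD !mcoeff0_minor !eqxx /= => /eqP.
  rewrite mulf_eq0 => /orP[/eqP //|].
  by case: (_ && _); rewrite -natrD ?(negPf nz2) ?oner_eq0.
rewrite diff_actZr hE mcoeffZ mcoeffD !mcoeff0_minor.
case: andP => [[/eqP Aj /eqP Bj]|_].
  by rewrite (uniqAB j l) ?eqxx in njl; auto.
case: andP => [[/eqP Aj /eqP Bj]|_].
  by rewrite (uniqAB j l) ?eqxx in njl; auto.
by rewrite addr0 mulr0.
Qed.

Lemma minorT A B : minor A B setT setT = subperm (~: A) (~: B).
Proof. by rewrite /minor !subsetT !setTD. Qed.

(** Each derivative of order k of the full permanent is a sum of minors that
    omit k rows and k columns. Stated for an arbitrary additive predicate P, so
    that the induction can peel one derivative off by passing to the preimage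
    of P under that derivative. *)
Lemma mderivm_subpermT_ind (P : R -> Prop) (u : 'X_{1..#|{: sym_var n}|}) :
    P 0 -> (forall G H, P G -> P H -> P (G + H)) ->
    (forall A B, #|A| = mdeg u -> #|B| = mdeg u -> P (minor A B setT setT)) ->
  P (subperm setT setT)^`M[u].
Proof.
have [k def_k] : exists k, mdeg u = k by exists (mdeg u).
rewrite def_k; elim: k u def_k P => [|k IH] u uk P P0 PD Pminor.
  move/eqP: uk; rewrite mdeg_eq0 => /eqP->; rewrite mderivm0m.
  by have := Pminor set0 set0; rewrite minorT !setC0 cards0; apply.
have [a ua] : exists a, (0 < u a)%N.
  apply/existsP; apply: contra_eqT uk; rewrite negb_exists => /forallP u0.
  by rewrite mdegE big1 // => a _; apply/eqP; rewrite -leqn0 leqNgt.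
have Uu : (U_(a) <= u)%MM.
  by apply/mnm_lepP => b; rewrite mnm1E; case: eqP => // <-.
rewrite -(submK Uu) mderivmDm mderivmU1m.
apply: (IH _ _ (fun G => P (mderiv a G))) => [||G H PG PH|A B cA cB].
- by move: uk; rewrite -{1}(submK Uu) mdegD mdeg1 addn1 => -[].
- by rewrite mderiv0.
- by rewrite mderivD; apply: PD.
have [i [j ->]] := var_surj a; rewrite mderiv_minor.
apply: PD; case: ifP => //; [case/andP=> iA jB|case/and3P=> _ iA jB];
  by apply: Pminor; rewrite cardsU1 ?iA ?jB ?cA ?cB.
Qed.

(** One representative for each unordered pair of sets of the same size, this
    size being in Q: ordering by rank is an arbitrary choice. *)
Definition ordered_pairs (Q : pred nat) : {set {set I} * {set I}} :=
  [set p : {set I} * {set I} |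
    [&& #|p.1| == #|p.2|, Q #|p.1| & (enum_rank p.1 <= enum_rank p.2)%N]].

(** The basis consists of the classes of the forms that remove the pairs: their
    action on F is, up to the factor 2, the family of permanents of
    complementary submatrices, which is free and spans the derivatives. *)
Lemma apolar_dim (Q : pred nat)
    (U : apolar_quot (permanent (generic_sym K n)) -> Prop) :
    2%:R != 0 :> K ->
    (forall q, U q <-> exists2 h : R,
       {in msupp h, forall u, Q (mdeg u)} & q = apolar_pi _ h) ->
  is_dim U #|ordered_pairs Q|.
Proof.
rewrite -subpermT in U * => nz2 UE.
pose p (x : 'I_#|ordered_pairs Q|) := enum_val x.
have pP x : [/\ #|(p x).1| = #|(p x).2|, Q #|(p x).1|
    & (enum_rank (p x).1 <= enum_rank (p x).2)%N].
  by have := enum_valP x; rewrite inE => /and3P[/eqP].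
have p_inj x y : (p x).1 = (p y).1 /\ (p x).2 = (p y).2
    \/ (p x).1 = (p y).2 /\ (p x).2 = (p y).1 -> x = y.
  move=> pij; apply: enum_val_inj; rewrite -/(p x) -/(p y).
  have [_ _ ri] := pP x; have [_ _ rj] := pP y.
  case: (p x) (p y) ri rj pij => [A B] [A' B'] /= ri rj [[-> -> //]|[eA eB]].
  suff eAB : A = B by rewrite -eA -eB eAB.
  apply/enum_rank_inj/val_inj/anti_leq; rewrite ri /=.
  by rewrite eA eB rj.
have /fin_all_exists[h hP] x : exists h : R, h \is #|(p x).1|.-homog
    /\ diff_act h (subperm setT setT) = 2%:R *: minor (p x).1 (p x).2 setT setT.
  have [cAB _ _] := pP x.
  have [h hk hE] := minor_pair_realizable nz2 cAB; exists h; split=> //.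
  by rewrite hE /minor_pair !minorT [X in _ + X]subpermC scaler_nat.
exists (fun x => apolar_pi _ (h x)); split.
- move=> x; apply/UE; exists (h x) => // u; have [/dhomogP hk _] := hP x.
  by move=> /hk ->; have [] := pP x.
- move=> c.
  under eq_bigr do rewrite -linearZ.
  rewrite -linear_sum /= => sum0.
  have {sum0} /eqP sum0 : \sum_x c x *: h x \in Ann (subperm setT setT).
    by rewrite -[X in X \in _]subr0 -apolar_piE sum0 linear0.
  rewrite diff_act_sum in sum0.
  apply: (@subperm_free _ (fun x => ~: (p x).1) (fun x => ~: (p x).2) c nz2)
    => [x|x y|].
  + apply/eqP; rewrite -(eqn_add2l #|(p x).1|) cardsC.
    by have [-> _ _] := pP x; rewrite cardsC.
  + by move=> e; apply: p_inj; case: e => -[/setC_inj-> /setC_inj->]; auto.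
  apply: (scalerI nz2); rewrite scaler0 -[RHS]sum0 scaler_sumr.
  apply: eq_bigr => x _.
  by rewrite diff_actZ (proj2 (hP x)) minorT !scalerA mulrC.
move=> q /UE[g gQ ->].
pose P (G : R) := exists c, G = \sum_x c x *: minor (p x).1 (p x).2 setT setT.
have P0 : P 0 by exists (fun=> 0); rewrite big1 // => x _; rewrite scale0r.
have PD G H : P G -> P H -> P (G + H).
  move=> [c ->] [d ->]; exists (fun x => c x + d x).
  by rewrite -big_split; apply: eq_bigr => x _; rewrite scalerDl.
have PZ a G : P G -> P (a *: G).
  move=> [c ->]; exists (fun x => a * c x).
  by rewrite scaler_sumr; apply: eq_bigr => x _; rewrite scalerA.
have Pmem A B : (A, B) \in ordered_pairs Q -> P (minor A B setT setT).
  move=> AB; exists (fun x => (x == enum_rank_in AB (A, B))%:R).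
  rewrite (bigD1 (enum_rank_in AB (A, B))) //= eqxx scale1r big1 ?addr0.
    by rewrite /p enum_rankK_in.
  by move=> x /negPf->; rewrite scale0r.
have [c cE] : P (diff_act g (subperm setT setT)).
  rewrite /diff_act big_seq; apply: big_ind => // u /gQ Qu; apply: PZ.
  apply: mderivm_subpermT_ind => // A B cA cB.
  have [AB|/ltnW BA] := leqP (enum_rank A) (enum_rank B).
    by apply: Pmem; rewrite inE /= cA cB Qu eqxx.
  by rewrite minorT subpermC -minorT; apply: Pmem; rewrite inE /= cA cB Qu eqxx.
(* The action on F of the form that removes (A, B) is twice the minor. *)
exists (fun x => c x / 2%:R).
under eq_bigr do rewrite -linearZ.
rewrite -linear_sum; apply/eqP; rewrite apolar_piE unfold_in.
rewrite -[diff_act _ _]/(diff_actr _ _) linearB /= /diff_actr subr_eq0.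
rewrite diff_act_sum cE; apply/eqP/eq_bigr => x _.
by rewrite diff_actZ (proj2 (hP x)) scalerA divfK.
Qed.

(** * Counting the pairs *)

(** Together with their mirror images, the ordered representatives cover all
    the pairs of sets of the same size, and the overlap is the diagonal. *)
Lemma card_ordered_pairs (Q : pred nat) :
  (#|ordered_pairs Q| * 2
   = \sum_(A : {set I} | Q #|A|) 'C(n, #|A|) + #|[set A : {set I} | Q #|A|]|)%N.
Proof.
pose sw (p : {set I} * {set I}) := (p.2, p.1).
have sw_inj : injective sw by apply: inv_inj => -[].
pose O := ordered_pairs Q; pose O' := sw @^-1: O.
have cO' : #|O'| = #|O| by rewrite card_preimset.
have OI : O :&: O' = (fun A => (A, A)) @: [set A : {set I} | Q #|A|].
  apply/setP => -[A B]; rewrite !inE /=; apply/idP/imsetP => [|[X + [-> ->]]].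
    case/andP=> /and3P[/eqP cAB QA AB] /and3P[_ _ BA]; exists A; rewrite ?inE //.
    by congr (_, _); apply/enum_rank_inj/val_inj/anti_leq; rewrite AB BA.
  by rewrite inE => QX; rewrite eqxx QX leqnn.
have OU : O :|: O' = [set p : {set I} * {set I} | Q #|p.1| & #|p.2| == #|p.1|].
  apply/setP => -[A B]; rewrite !inE /= [RHS]andbC [in RHS]eq_sym.
  by have [eAB|//] := eqVneq #|A| #|B|; rewrite /= -eAB -andb_orr leq_total andbT.
rewrite muln2 -addnn -{2}cO' -cardsUI OI OU card_imset; last by move=> A B [].
congr (_ + _)%N; rewrite -sum1dep_card.
rewrite -(pair_big_dep (fun A : {set I} => Q #|A|)
            (fun A B : {set I} => #|B| == #|A|) (fun _ _ => 1%N)) /=.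
by apply: eq_bigr => A _; rewrite sum1dep_card card_draws card_ord.
Qed.

Lemma card_ordered_pairs1 k :
  #|ordered_pairs (pred1 k)| = (('C(n, k) * ('C(n, k) + 1)) %/ 2)%N.
Proof.
have cK : #|[set A : {set I} | #|A| == k]| = 'C(n, k).
  by rewrite card_draws card_ord.
rewrite -[LHS](mulnK _ (isT : (0 < 2)%N)) card_ordered_pairs /= cK mulnDr muln1.
congr ((_ + _) %/ 2)%N; under eq_bigr => A /eqP-> do [].
by rewrite sum_nat_cond_const cK.
Qed.

Lemma card_ordered_pairsT :
  #|ordered_pairs predT| = (('C(2 * n, n) + 2 ^ n) %/ 2)%N.
Proof.
rewrite -[LHS](mulnK _ (isT : (0 < 2)%N)) card_ordered_pairs /=.
congr ((_ + _) %/ 2)%N; last first.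
  rewrite -[in RHS](card_ord n) -cardsT -card_powerset powersetT.
  by apply: eq_card => A; rewrite !inE.
rewrite (partition_big (fun A : {set I} => inord #|A| : 'I_n.+1) predT) //=.
rewrite mul2n -addnn -binomial.Vandermonde; apply: eq_bigr => k _.
have le_n (A : {set I}) : (#|A| < n.+1)%N.
  by rewrite ltnS -[leqRHS](card_ord n) max_card.
rewrite (eq_bigl (fun A : {set I} => #|A| == k)) => [|A]; last first.
  by rewrite -val_eqE /= inordK.
under eq_bigr => A /eqP-> do [].
by rewrite sum_nat_cond_const card_draws card_ord bin_sub // -ltnS.
Qed.

End Subpermanents.

Lemma two_neq0 (K : fieldType) :
    [pchar K] =i pred0 \/ (exists2 p : nat, (2 < p)%N & p \in [pchar K]) ->
  2%:R != 0 :> K.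
Proof.
move=> K_char; apply/negP => K2.
have char2 : 2%N \in [pchar K] by rewrite inE.
case: K_char => [/(_ 2%N)|[p gt2 pK]]; first by rewrite char2.
by move: char2; rewrite (pcharf_eq pK) inE => /eqP p2; rewrite -p2 in gt2.
Qed.

Theorem lemma3p16 (K : fieldType)
    (K_infinite : forall s : seq K, exists x : K, x \notin s)
    (K_char : [pchar K]%R =i pred0 \/
              (exists2 p : nat, (2 < p)%N & p \in [pchar K]%R))
    (n : nat) :
  let F := permanent (generic_sym K n) in
  (forall k : nat, (k <= n)%N ->
     is_dim (graded_piece F k) (('C(n, k) * ('C(n, k) + 1)) %/ 2)%N)
  /\ is_dim (fun _ : apolar_quot F => True) (('C(2 * n, n) + 2 ^ n) %/ 2)%N.
Proof.
have nz2 := two_neq0 K_char.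
split=> [k _|].
  rewrite -card_ordered_pairs1; apply: apolar_dim => // q.
  split=> -[h hk ->]; exists h => //; first by move=> u /(dhomogP _ _ _ hk)/eqP.
  by apply/dhomogP => u /hk/eqP.
rewrite -card_ordered_pairsT; apply: apolar_dim => // q; split=> // _.
by have [h ->] := apolar_piP q; exists h.
Qed.
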